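(* Let $k$ be an algebraically closed field and let $\mathscr{C}$ be an essentially small $k$-linear, Hom-finite, Krull--Schmidt, 2-Calabi--Yau triangulated category. Let $\mathscr{T}$ and $\mathscr{U}$ be any two cluster tilting subcategories of $\mathscr{C}$. Then the homomorphisms $$\overline{\mathrm{ind}}_{\mathscr{U}}\big|_{K_0^{\mathrm{split}}(\mathscr{T})}: K_0^{\mathrm{split}}(\mathscr{T})\to K_0^{\mathrm{split}}(\mathscr{U}) \quad\text{and}\quad \mathrm{ind}_{\mathscr{T}}\big|_{K_0^{\mathrm{split}}(\mathscr{U})}: K_0^{\mathrm{split}}(\mathscr{U})\to K_0^{\mathrm{split}}(\mathscr{T})$$ are mutually inverse isomorphisms.
   Context: The suspension functor of $\mathscr{C}$ is $\Sigma$. A cluster tilting subcategory of $\mathscr{C}$ is a full subcategory $\mathscr{T}$ (closed under isomorphisms) which is functorially finite (every object of $\mathscr{C}$ has a right and a left $\mathscr{T}$-approximation) and satisfies $\mathscr{T}=\{c\in\mathscr{C}\mid \mathrm{Hom}_{\mathscr{C}}(\Sigma^{-1}t,c)=0\ \forall t\in\mathscr{T}\}=\{c\in\mathscr{C}\mid \mathrm{Hom}_{\mathscr{C}}(c,\Sigma t)=0\ \forall t\in\mathscr{T}\}$. $K_0^{\mathrm{split}}(-)$ is the split Grothendieck group of an additive category; $K_0^{\mathrm{split}}(\mathscr{T})$ is free abelian on the classes $[t]$ of the isomorphism classes $t\in\mathrm{Indec}(\mathscr{T})$ of indecomposable objects of $\mathscr{T}$, and is a subgroup of $K_0^{\mathrm{split}}(\mathscr{C})$.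 For each $s\in\mathscr{C}$ there is a distinguished triangle $t_1\to t_0\to s\to\Sigma t_1$ with $t_0,t_1\in\mathscr{T}$; the index of $s$ is $\mathrm{ind}_{\mathscr{T}}(s)=[t_0]-[t_1]\in K_0^{\mathrm{split}}(\mathscr{T})$ (it is well defined). This induces a homomorphism $\mathrm{ind}_{\mathscr{T}}:K_0^{\mathrm{split}}(\mathscr{C})\to K_0^{\mathrm{split}}(\mathscr{T})$, $[s]\mapsto \mathrm{ind}_{\mathscr{T}}(s)$. A cluster tilting subcategory of $\mathscr{C}$ is also one of the opposite category $\mathscr{C}^{\mathrm{op}}$, and one identifies $K_0^{\mathrm{split}}(\mathscr{C}^{\mathrm{op}})=K_0^{\mathrm{split}}(\mathscr{C})$. $\overline{\mathrm{ind}}_{\mathscr{U}}$ denotes the index map with respect to $\mathscr{U}$ computed in $\mathscr{C}^{\mathrm{op}}$: if $c\to u^0\to u^1\to \Sigma c$ is a distinguished triangle in $\mathscr{C}$ with $u^0,u^1\in\mathscr{U}$, then $\overline{\mathrm{ind}}_{\mathscr{U}}(c)=[u^0]-[u^1]$. *)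

(* Defs.v *)
From HB Require Import structures.
From mathcomp Require Import all_boot all_order all_algebra.
From mathcomp Require Import ring_quotient.
From mathcomp Require Import boolp classical_sets.
From mathcomp Require Import freeg.

Set Implicit Arguments.
Unset Strict Implicit.
Unset Printing Implicit Defensive.

Import GRing.Theory.
Local Open Scope quotient_scope.
Local Open Scope ring_scope.

(* k-linear, Hom-finite categories: a [vectType k] is finite dimensional.
   Objects form a type, so no further smallness condition is needed. *)
Record linear_category (k : fieldType) := LinearCategory {
  obj :> Type;
  hom : obj -> obj -> vectType k;
  idm : forall x, hom x x;
  compm : forall x y z, hom y z -> hom x y -> hom x z;
  compm_linearl : forall x y z (f : hom x y), linear (fun g : hom y z => compm g f);
  compm_linearr : forall x y z (g : hom y z), linear (fun f : hom x y => compm g f);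
  compmA : forall w x y z (h : hom y z) (g : hom x y) (f : hom w x),
    compm h (compm g f) = compm (compm h g) f;
  comp1m : forall x y (f : hom x y), compm (idm y) f = f;
  compm1 : forall x y (f : hom x y), compm f (idm x) = f }.

Arguments hom {k l}.
Arguments idm {k l}.
Arguments compm {k l x y z}.

Notation "g '\oc' f" := (compm g f) (at level 40, left associativity).

Section Categories.
Variables (k : fieldType) (C : linear_category k).
Implicit Types x y z a b c : C.

Definition is_iso x y (f : hom x y) : Prop :=
  exists g : hom y x, g \oc f = idm x /\ f \oc g = idm y.

Definition isomorphic x y : Prop := exists f : hom x y, is_iso f.

Definition is_zero z : Prop :=
  forall x, (forall f : hom x z, f = 0) /\ (forall f : hom z x, f = 0).

Definition is_biproduct a b c : Prop :=
  exists (i1 : hom a c) (i2 : hom b c) (p1 : hom c a) (p2 : hom c b),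
    [/\ p1 \oc i1 = idm a, p2 \oc i2 = idm b, p2 \oc i1 = 0, p1 \oc i2 = 0
      & i1 \oc p1 + i2 \oc p2 = idm c].

Definition is_direct_sum n (x : 'I_n -> C) c : Prop :=
  exists (i : forall j, hom (x j) c) (p : forall j, hom c (x j)),
    [/\ forall j, p j \oc i j = idm (x j),
        forall j l, j != l -> p l \oc i j = 0
      & \sum_j (i j \oc p j) = idm c].

Definition is_additive : Prop :=
  (exists z, is_zero z) /\ (forall a b, exists c, is_biproduct a b c).

Definition local_End x : Prop :=
  idm x <> 0 /\
  forall f g : hom x x, ~ is_iso f -> ~ is_iso g -> ~ is_iso (f + g).

Definition krull_schmidt : Prop :=
  forall c, exists n (x : 'I_n -> C),
    is_direct_sum x c /\ forall j, local_End (x j).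

Definition full_subcategory (T : set C) : linear_category k :=
  @LinearCategory k T (fun x y : T => hom (val x) (val y))
    (fun x : T => idm (val x))
    (fun (x y z : T) (g : hom (val y) (val z)) (f : hom (val x) (val y)) => g \oc f)
    (fun (x y z : T) (f : hom (val x) (val y)) => @compm_linearl k C _ _ (val z) f)
    (fun (x y z : T) (g : hom (val y) (val z)) => @compm_linearr k C (val x) _ _ g)
    (fun (w x y z : T) (h : hom (val y) (val z)) (g : hom (val x) (val y))
      (f : hom (val w) (val x)) => compmA h g f)
    (fun (x y : T) (f : hom (val x) (val y)) => comp1m f)
    (fun (x y : T) (f : hom (val x) (val y)) => compm1 f).

Definition right_approximation (T : set C) c t (f : hom t c) : Prop :=
  T t /\ forall t', T t' -> forall g : hom t' c, exists h : hom t' t, f \oc h = g.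

Definition left_approximation (T : set C) c t (f : hom c t) : Prop :=
  T t /\ forall t', T t' -> forall g : hom c t', exists h : hom t t', h \oc f = g.

Definition functorially_finite (T : set C) : Prop :=
  forall c, (exists t (f : hom t c), right_approximation T f) /\
            (exists t (f : hom c t), left_approximation T f).

End Categories.

(* Functors between k-linear categories are understood to be k-linear. *)
Record functor (k : fieldType) (C D : linear_category k) := Functor {
  fobj :> C -> D;
  fmap : forall x y, {linear hom x y -> hom (fobj x) (fobj y)};
  fmap1 : forall x, fmap x x (idm x) = idm (fobj x);
  fmapM : forall x y z (g : hom y z) (f : hom x y),
    fmap x z (g \oc f) = fmap y z g \oc fmap x y f }.

Arguments fmap {k C D} _ {x y}.

Section Functors.
Variables (k : fieldType) (C D E : linear_category k).

Definition id_functor : functor C C :=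
  @Functor k C C id (fun x y => idfun) (fun _ => erefl) (fun _ _ _ _ _ => erefl).

Lemma comp_functor1 (G : functor D E) (F : functor C D) x :
  fmap G (fmap F (idm x)) = idm (G (F x)).
Proof. by rewrite !fmap1. Qed.

Lemma comp_functorM (G : functor D E) (F : functor C D)
    x y z (g : hom y z) (f : hom x y) :
  fmap G (fmap F (g \oc f)) = fmap G (fmap F g) \oc fmap G (fmap F f).
Proof. by rewrite !fmapM. Qed.

Definition comp_functor (G : functor D E) (F : functor C D) : functor C E :=
  @Functor k C E (G \o F) (fun x y => fmap G \o fmap F)
    (comp_functor1 G F) (@comp_functorM G F).

Definition naturally_isomorphic (F G : functor C D) : Prop :=
  exists eta : forall x, hom (F x) (G x),
    (forall x, is_iso (eta x)) /\
    (forall x y (f : hom x y), eta y \oc fmap F f = fmap G f \oc eta x).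

End Functors.

(* The suspension is an autoequivalence, given with a quasi-inverse. *)
Record triangulated_category (k : fieldType) := TriangulatedCategory {
  tcat :> linear_category k;
  susp : functor tcat tcat;
  desusp : functor tcat tcat;
  suspK : naturally_isomorphic (comp_functor desusp susp) (id_functor tcat);
  desuspK : naturally_isomorphic (comp_functor susp desusp) (id_functor tcat);
  tcat_additive : is_additive tcat;
  (* [distinguished f g h]: x --f--> y --g--> z --h--> susp x is distinguished *)
  distinguished : forall x y z : tcat,
    hom x y -> hom y z -> hom z (susp x) -> Prop;
  TR1_iso : forall (x y z x' y' z' : tcat)
      (f : hom x y) (g : hom y z) (h : hom z (susp x))
      (f' : hom x' y') (g' : hom y' z') (h' : hom z' (susp x'))
      (a : hom x x') (b : hom y y') (c : hom z z'),
    is_iso a -> is_iso b -> is_iso c ->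
    b \oc f = f' \oc a -> c \oc g = g' \oc b -> fmap susp a \oc h = h' \oc c ->
    distinguished f g h -> distinguished f' g' h';
  TR1_id : forall x z : tcat, is_zero z ->
    distinguished (idm x) (0 : hom x z) (0 : hom z (susp x));
  TR1_cone : forall (x y : tcat) (f : hom x y),
    exists z (g : hom y z) (h : hom z (susp x)), distinguished f g h;
  TR2 : forall (x y z : tcat) (f : hom x y) (g : hom y z) (h : hom z (susp x)),
    distinguished f g h <-> distinguished g h (- fmap susp f);
  TR3 : forall (x y z x' y' z' : tcat)
      (f : hom x y) (g : hom y z) (h : hom z (susp x))
      (f' : hom x' y') (g' : hom y' z') (h' : hom z' (susp x'))
      (a : hom x x') (b : hom y y'),
    distinguished f g h -> distinguished f' g' h' -> b \oc f = f' \oc a ->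
    exists c : hom z z', c \oc g = g' \oc b /\ fmap susp a \oc h = h' \oc c;
  TR4 : forall (x y z x' y' z' : tcat) (f : hom x y) (g : hom y z)
      (p : hom y z') (q : hom z' (susp x))
      (r : hom z x') (s : hom x' (susp y))
      (t : hom z y') (u : hom y' (susp x)),
    distinguished f p q -> distinguished g r s -> distinguished (g \oc f) t u ->
    exists (v : hom z' y') (w : hom y' x'),
      [/\ distinguished v w (fmap susp p \oc s),
          v \oc p = t \oc g, u \oc v = q, w \oc t = r
        & s \oc w = fmap susp f \oc u] }.

Arguments susp {k _}.
Arguments desusp {k _}.
Arguments distinguished {k _ x y z}.

Section Triangulated.
Variables (k : fieldType) (C : triangulated_category k).

(* An isomorphism Hom(x, y) = D Hom(y, susp^2 x), natural in x and y, where
   D is the k-linear dual. *)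
Definition two_calabi_yau : Prop :=
  exists phi : forall x y : C, 'Hom(hom x y, 'Hom(hom y (susp (susp x)), k^o)),
    [/\ forall x y, bijective (phi x y),
        forall x y y' (f : hom x y) (g : hom y y') (h : hom y' (susp (susp x))),
          phi x y' (g \oc f) h = phi x y f (h \oc g)
      & forall x' x y (e : hom x' x) (f : hom x y) (h : hom y (susp (susp x'))),
          phi x' y (f \oc e) h = phi x y f (fmap susp (fmap susp e) \oc h)].

Definition cluster_tilting (T : set C) : Prop :=
  [/\ forall x y : C, isomorphic x y -> T x -> T y,
      functorially_finite T,
      T = [set c | forall t, T t -> forall f : hom (desusp t) c, f = 0]%classic
    & T = [set c | forall t, T t -> forall f : hom c (susp t), f = 0]%classic].

End Triangulated.

Section SplitGrothendieck.
Variables (k : fieldType) (A : linear_category k).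

(* The free abelian group on the objects of A; [{classic _}] only equips the
   type of objects with decidable equality and choice. *)
Definition free_on_objects : zmodType := {freeg {classic A} / int}.

Definition free_class (a : A) : free_on_objects := << (a : {classic A}) >>.

(* The subgroup generated by the [c] - [a] - [b] with c a biproduct of a and b.
   It identifies isomorphic objects: if z is zero, then z is a biproduct of z
   and z, and any c' isomorphic to c is a biproduct of c and z. *)
Inductive split_relation : free_on_objects -> Prop :=
| split_relation_biproduct a b c : is_biproduct a b c ->
    split_relation (free_class c - free_class a - free_class b)
| split_relation0 : split_relation 0
| split_relationB u v :
    split_relation u -> split_relation v -> split_relation (u - v).

Definition split_relations : {pred free_on_objects} :=
  [pred u | `[< split_relation u >]].

Lemma split_relations_zmod_closed : zmod_closed split_relations.
Proof.
split=> [|u v /asboolP su /asboolP sv]; apply/asboolP.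
  exact: split_relation0.
exact: split_relationB.
Qed.

HB.instance Definition _ :=
  GRing.isZmodClosed.Build free_on_objects split_relations
    split_relations_zmod_closed.

Definition K0split : zmodType := Quotient.quot split_relations.

Definition K0class (a : A) : K0split :=
  \pi_(Quotient.quot split_relations) (free_class a).

Definition biproduct_additive (G : zmodType) (f : A -> G) : Prop :=
  forall a b c, is_biproduct a b c -> f c = f a + f b.

Lemma K0class_biproduct : biproduct_additive K0class.
Proof.
move=> a b c abc; apply/eqP; rewrite /K0class -raddfD -Quotient.idealrBE.
apply/asboolP; rewrite opprD addrA.
exact: split_relation_biproduct.
Qed.

Section Lift.
Variables (G : zmodType) (f : A -> G).

Definition K0lift_fun (x : K0split) : G :=
  fglift (f : {classic A} -> zmodule G) (repr x).

Hypothesis fD : biproduct_additive f.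

Let F : free_on_objects -> G := fglift (f : {classic A} -> zmodule G).

Let FB : zmod_morphism F.
Proof. exact: (@lift_is_additive _ _ (zmodule G)). Qed.

Let F_class a : F (free_class a) = f a.
Proof. by rewrite /F liftU scale1r. Qed.

Let F_eq u v : \pi_(Quotient.quot split_relations) u = \pi v -> F u = F v.
Proof.
move/eqP; rewrite -Quotient.idealrBE => /asboolP uv.
apply/eqP; rewrite -subr_eq0 -FB; apply/eqP.
elim: uv => [a b c abc||? ? _ F1 _ F2]; last by rewrite FB F1 F2 subrr.
  by rewrite !FB !F_class (fD abc) addrAC addrK subrr.
by rewrite -(subrr 0) FB subrr.
Qed.

Lemma K0lift_is_zmod_morphism : zmod_morphism K0lift_fun.
Proof.
move=> x y; rewrite /K0lift_fun -FB; apply: F_eq.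
by rewrite raddfB /= !reprK.
Qed.

Lemma K0lift_funE a : K0lift_fun (K0class a) = f a.
Proof.
by rewrite -F_class; apply: F_eq; rewrite reprK.
Qed.

Definition K0lift of biproduct_additive f := K0lift_fun.

HB.instance Definition _ :=
  GRing.isZmodMorphism.Build K0split G (K0lift fD) K0lift_is_zmod_morphism.

Lemma K0liftE a : K0lift fD (K0class a) = f a.
Proof. exact: K0lift_funE. Qed.

End Lift.

End SplitGrothendieck.

Section Index.
Variables (k : fieldType) (C : triangulated_category k).
Implicit Types T U : set C.

Lemma K0class_val_biproduct T :
  biproduct_additive (fun t : full_subcategory T => K0class (val t) : K0split C).
Proof.
by move=> a b c [i1 [i2 [p1 [p2 ?]]]]; apply: K0class_biproduct; exists i1, i2, p1, p2.
Qed.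

(* The map along which one restricts homomorphisms from [K0split C] to
   [K0split (full_subcategory T)]. *)
Definition K0incl T : {additive K0split (full_subcategory T) -> K0split C} :=
  K0lift (@K0class_val_biproduct T).

Definition is_index T
    (phi : {additive K0split C -> K0split (full_subcategory T)}) : Prop :=
  forall (t1 t0 : full_subcategory T) (s : C)
    (f : hom (val t1) (val t0)) (g : hom (val t0) s) (h : hom s (susp (val t1))),
    distinguished f g h -> phi (K0class s) = K0class t0 - K0class t1.

(* The index in the opposite category, spelled out in C. *)
Definition is_coindex U
    (phi : {additive K0split C -> K0split (full_subcategory U)}) : Prop :=
  forall (c : C) (u0 u1 : full_subcategory U)
    (f : hom c (val u0)) (g : hom (val u0) (val u1)) (h : hom (val u1) (susp c)),
    distinguished f g h -> phi (K0class c) = K0class u0 - K0class u1.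

(* When T is cluster tilting, exactly one homomorphism satisfies [is_index T]
   and exactly one satisfies [is_coindex T]; the default 0 is then not used. *)
Definition ind T : {additive K0split C -> K0split (full_subcategory T)} :=
  xget (\0 : {classic {additive K0split C -> K0split (full_subcategory T)}})
    (@is_index T).

Definition coind U : {additive K0split C -> K0split (full_subcategory U)} :=
  xget (\0 : {classic {additive K0split C -> K0split (full_subcategory U)}})
    (@is_coindex U).

Definition ind_restr T U :
    {additive K0split (full_subcategory U) -> K0split (full_subcategory T)} :=
  ind T \o K0incl U.

Definition coind_restr U T :
    {additive K0split (full_subcategory T) -> K0split (full_subcategory U)} :=
  coind U \o K0incl T.

End Index.

(* Main.v *)
(* The key fact is that the index is additive on a triangle
   t -> b -> c -> susp t with t in T, that is, ind b = [t] + ind c: if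
   t1 -> t0 -> c is an index triangle of c, then the composite
   t0 -> c -> susp t vanishes, and the octahedral axiom turns this into a
   triangle t1 -> m -> b with m a biproduct of t and t0. Applied to a coindex
   triangle t -> u0 -> u1 -> susp t, it gives
   ind_T (coind_U [t]) = ind_T u0 - ind_T u1 = [t]. Since coind c = - ind (susp c),
   the other composite follows by applying it, with U in place of T, to the
   rotation u -> susp t1 -> susp t0 -> susp u of an index triangle
   t1 -> t0 -> u. *)
Require Import Defs.
From HB Require Import structures.
From mathcomp Require Import all_boot all_order all_algebra.
From mathcomp Require Import boolp classical_sets.
From mathcomp Require Import freeg.

Set Implicit Arguments.
Unset Strict Implicit.
Unset Printing Implicit Defensive.

(* [Defs] is imported again because [all_algebra] exports another [hom]. *)
Import GRing.Theory Defs.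
Local Open Scope ring_scope.

(** * Bilinear composition and biproducts in a linear category *)

Section LinearCategory.
Variables (k : fieldType) (C : linear_category k).
Implicit Types x y z a b c : C.

Lemma compmDl x y z (f g : hom y z) (h : hom x y) :
  (f + g) \oc h = f \oc h + g \oc h.
Proof. by have := compm_linearl h 1 f g; rewrite !scale1r. Qed.

Lemma compmDr x y z (f g : hom x y) (h : hom y z) :
  h \oc (f + g) = h \oc f + h \oc g.
Proof. by have := compm_linearr h 1 f g; rewrite !scale1r. Qed.

Lemma comp0m x y z (h : hom x y) : (0 : hom y z) \oc h = 0.
Proof. by apply: (addIr (0 \oc h)); rewrite -compmDl !add0r. Qed.

Lemma compm0 x y z (h : hom y z) : h \oc (0 : hom x y) = 0.
Proof. by apply: (addIr (h \oc 0)); rewrite -compmDr !add0r. Qed.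

Lemma compNm x y z (f : hom y z) (h : hom x y) : (- f) \oc h = - (f \oc h).
Proof. by apply: (addIr (f \oc h)); rewrite -compmDl !addNr comp0m. Qed.

Lemma compmN x y z (f : hom x y) (h : hom y z) : h \oc (- f) = - (h \oc f).
Proof. by apply: (addIr (h \oc f)); rewrite -compmDr !addNr compm0. Qed.

Lemma compmBl x y z (f g : hom y z) (h : hom x y) :
  (f - g) \oc h = f \oc h - g \oc h.
Proof. by rewrite compmDl compNm. Qed.

Lemma compmBr x y z (f g : hom x y) (h : hom y z) :
  h \oc (f - g) = h \oc f - h \oc g.
Proof. by rewrite compmDr compmN. Qed.

Lemma is_iso_idm x : is_iso (idm x).
Proof. by exists (idm x); rewrite comp1m. Qed.

Lemma isomorphic_sym x y : isomorphic x y -> isomorphic y x.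
Proof. by case=> f [g [gf fg]]; exists g, f. Qed.

Lemma is_biproduct_sym a b c : is_biproduct a b c -> is_biproduct b a c.
Proof.
case=> i1 [i2 [p1 [p2 [? ? ? ? eq1]]]].
by exists i2, i1, p2, p1; split=> //; rewrite addrC.
Qed.

Lemma is_biproduct_iso a b c c' :
  isomorphic c c' -> is_biproduct a b c -> is_biproduct a b c'.
Proof.
case=> u [v [vu uv]] [i1 [i2 [p1 [p2 [e11 e22 e21 e12 eq1]]]]].
exists (u \oc i1), (u \oc i2), (p1 \oc v), (p2 \oc v).
have cancel_vu w w' (f : hom w c) (g : hom c w') :
  g \oc v \oc (u \oc f) = g \oc f by rewrite compmA -(compmA g) vu compm1.
split; rewrite ?cancel_vu //.
by rewrite -!compmA -compmDr !compmA -compmDl eq1 comp1m uv.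
Qed.

End LinearCategory.

(** * Linear functors and retractions up to natural isomorphism *)

Section Functor.
Variables (k : fieldType) (C D : linear_category k).
Implicit Types (F : functor C D) (G : functor D C).

Lemma fmap0 F (x y : C) : fmap F (0 : hom x y) = 0.
Proof. exact: linear0. Qed.

Lemma fmapD F (x y : C) (f g : hom x y) :
  fmap F (f + g) = fmap F f + fmap F g.
Proof. exact: linearD. Qed.

Lemma fmap_biproduct F (a b c : C) :
  is_biproduct a b c -> is_biproduct (F a) (F b) (F c).
Proof.
case=> i1 [i2 [p1 [p2 [e11 e22 e21 e12 eq1]]]].
exists (fmap F i1), (fmap F i2), (fmap F p1), (fmap F p2).
by rewrite -!fmapM -fmapD eq1 e11 e22 e21 e12 !fmap1 !fmap0.
Qed.

Lemma fmap_zero F (z : C) : is_zero z -> is_zero (F z).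
Proof.
move=> z0; have id0 : idm (F z) = 0 by rewrite -fmap1 ((z0 z).1 (idm z)) fmap0.
move=> x; split=> f.
  by rewrite -[f]comp1m id0 comp0m.
by rewrite -[f]compm1 id0 compm0.
Qed.

Lemma retractionP F G :
  naturally_isomorphic (comp_functor G F) (id_functor C) ->
  exists eta : forall x, hom (G (F x)) x, (forall x, is_iso (eta x)) /\
    (forall x y (f : hom x y), eta y \oc fmap G (fmap F f) = f \oc eta x).
Proof. by []. Qed.

Lemma retraction_fmap_inj F G :
  naturally_isomorphic (comp_functor G F) (id_functor C) ->
  forall x y : C, injective (@fmap k C D F x y).
Proof.
case/retractionP=> eta [eta_iso eta_nat] x y f g fg.
have [v [vK Kv]] := eta_iso x.
by rewrite -(compm1 f) -(compm1 g) -Kv !compmA -!eta_nat fg.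
Qed.

End Functor.

(** * The suspension is fully faithful and essentially surjective *)

Section Suspension.
Variables (k : fieldType) (C : triangulated_category k).
Implicit Types x y z a b c : C.

Lemma susp_inj x y : injective (@fmap k C C susp x y).
Proof. exact: retraction_fmap_inj (suspK C) x y. Qed.

Lemma desusp_inj x y : injective (@fmap k C C desusp x y).
Proof. exact: retraction_fmap_inj (desuspK C) x y. Qed.

Lemma susp_full x y (h : hom (susp x) (susp y)) : exists f, fmap susp f = h.
Proof.
have [eta [eta_iso eta_nat]] := retractionP (suspK C).
have [u [uK Ku]] := eta_iso x; have [v [vK Kv]] := eta_iso y.
(* The preimage is [desusp h] conjugated by [eta]; naturality gives the equality after [desusp],
   which is faithful. *)
exists (eta y \oc fmap desusp h \oc u); apply: desusp_inj.
have := eta_nat _ _ (eta y \oc fmap desusp h \oc u).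
rewrite -!compmA uK compm1 => /(congr1 (compm v)).
by rewrite !compmA vK !comp1m.
Qed.

Lemma susp_surj z : exists x, isomorphic (susp x) z.
Proof.
have [eps [eps_iso _]] := retractionP (desuspK C).
by exists (desusp z), (eps z); apply: eps_iso.
Qed.

Lemma susp_biproduct_inv a b c :
  is_biproduct (susp a) (susp b) (susp c) -> is_biproduct a b c.
Proof.
case=> I1 [I2 [P1 [P2]]].
have [[i1 <-] [i2 <-]] := (susp_full I1, susp_full I2).
have [[p1 <-] [p2 <-]] := (susp_full P1, susp_full P2).
rewrite -!fmapM -fmapD -!fmap1 => -[e11 e22 e21 e12 eq1].
exists i1, i2, p1, p2; split; apply: susp_inj => //.
  by rewrite e21 fmap0.
by rewrite e12 fmap0.
Qed.

End Suspension.

(** * Exactness, splitting and rotation of triangles *)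

Section Triangles.
Variables (k : fieldType) (C : triangulated_category k).
Implicit Types x y z w a b c m p q : C.

(** Mapping the triangle of [idm x] to the given one factors [g \oc f] through a zero object. *)
Lemma triangle_comp0 x y z (f : hom x y) (g : hom y z) (h : hom z (susp x)) :
  distinguished f g h -> g \oc f = 0.
Proof.
move=> fgh; have [[z0 z00] _] := tcat_additive C.
have [|c [<- _]] := TR3 (a := idm x) (b := f) (TR1_id x z00) fgh => //.
exact: compm0.
Qed.

Lemma triangle_id_zero w z : is_zero z ->
  distinguished (0 : hom z w) (idm w) (0 : hom w (susp z)).
Proof.
move=> z0; rewrite TR2 fmap0 oppr0.
apply: TR1_id; exact: fmap_zero.
Qed.

Lemma triangle_weak_coker x y z w (f : hom x y) (g : hom y z)
    (h : hom z (susp x)) (u : hom y w) :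
  distinguished f g h -> u \oc f = 0 -> exists v, u = v \oc g.
Proof.
move=> fgh uf0; have [[z0 z00] _] := tcat_additive C.
have [|c [cg _]] := TR3 (a := 0) (b := u) fgh (triangle_id_zero w z00).
  by rewrite uf0 compm0.
by exists c; rewrite cg comp1m.
Qed.

(** TR3 on rotated triangles gives a map [susp w -> susp x], which desuspends by fullness; the signs
    cancel. *)
Lemma triangle_weak_ker x y z w (f : hom x y) (g : hom y z)
    (h : hom z (susp x)) (u : hom w y) :
  distinguished f g h -> g \oc u = 0 -> exists v, u = f \oc v.
Proof.
rewrite TR2 => fgh gu0; have [[z0 z00] _] := tcat_additive C.
have := TR1_id w z00; rewrite TR2 => w0.
have [|c []] := TR3 (a := u) (b := 0) w0 fgh; first by rewrite gu0 compm0.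
have [v <-] := susp_full c => _.
rewrite fmap1 compmN compm1 compNm => /oppr_inj; rewrite -fmapM => /susp_inj.
by exists v.
Qed.

(* The connecting map vanishes exactly when the triangle splits: one direction
   here, the other in [biproduct_triangle]. *)
Lemma split_triangle x m y (f : hom x m) (g : hom m y) :
  distinguished f g (0 : hom y (susp x)) -> is_biproduct x y m.
Proof.
move=> fgh; have gf0 := triangle_comp0 fgh.
have fgh' := fgh; rewrite TR2 in fgh'.
(* As the connecting map is zero, the identity of [y] lifts along [g] to a section [s]. *)
have [|s es] := triangle_weak_ker (u := idm y) fgh'; first by rewrite comp0m.
have f_mono w (u : hom w x) : f \oc u = 0 -> u = 0.
  rewrite TR2 in fgh' => fu0.
  have [|v] := triangle_weak_ker (u := fmap susp u) fgh'.
    by rewrite compNm -fmapM fu0 fmap0 oppr0.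
  by rewrite comp0m => e; apply: susp_inj; rewrite e fmap0.
have [|r er] := triangle_weak_ker (u := idm m - s \oc g) fgh.
  by rewrite compmBr compm1 compmA -es comp1m subrr.
exists f, s, r, g; split=> //.
- apply/eqP; rewrite -subr_eq0; apply/eqP/f_mono.
  by rewrite compmBr compmA -er compmBl -compmA gf0 compm0 comp1m compm1 subr0 subrr.
- apply: f_mono.
  by rewrite compmA -er compmBl -compmA -es comp1m compm1 subrr.
- by rewrite -er subrK.
Qed.

(** The cone of [i1] is identified with [b]: since [i1] is a split monomorphism, [h] vanishes, so
    the map [phi] induced by [p2] has inverse [g \oc i2]. *)
Lemma biproduct_triangle a b c : is_biproduct a b c ->
  exists (f : hom a c) (g : hom c b), distinguished f g (0 : hom b (susp a)).
Proof.
case=> i1 [i2 [p1 [p2 [e11 e22 e21 e12 eq1]]]].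
have [z [g [h igh]]] := TR1_cone i1.
have h0 : h = 0.
  have := igh; rewrite TR2 TR2 => /triangle_comp0; rewrite compNm => /eqP.
  rewrite oppr_eq0 => /eqP /(congr1 (compm (fmap susp p1))).
  by rewrite compmA -fmapM e11 fmap1 comp1m compm0.
have [phi ephi] := triangle_weak_coker igh e21; have igh' := igh.
have phiK : phi \oc (g \oc i2) = idm b by rewrite compmA -ephi.
exists i1, p2; apply: TR1_iso (is_iso_idm _) (is_iso_idm _) _ _ _ _ igh';
  rewrite ?comp1m ?compm1 //; first 1 last.
- exact/esym/ephi.
- by rewrite fmap1 comp1m comp0m.
exists (g \oc i2); split=> //.
apply/eqP; rewrite -subr_eq0; apply/eqP.
have [||v ->] := triangle_weak_coker
  (f := g) (g := h) (h := - fmap susp i1) (u := g \oc i2 \oc phi - idm z).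
- by rewrite -TR2.
- rewrite compmBl -!compmA -ephi comp1m.
  have -> : i2 \oc p2 = idm c - i1 \oc p1 by rewrite -eq1 addrC addKr.
  by rewrite compmBr compm1 compmA (triangle_comp0 igh) comp0m subr0 subrr.
- by rewrite h0 compm0.
Qed.

(** By fullness [e] is [- susp f] for some [f], so TR2 can be read backwards. *)
Lemma unrotate x y z (g : hom y z) (h : hom z (susp x))
    (e : hom (susp x) (susp y)) :
  distinguished g h e -> exists f, distinguished f g h.
Proof.
have [f ef] := susp_full (- e); exists f.
by rewrite TR2 ef opprK.
Qed.

Lemma triangle_desusp y z w (g : hom y z) (h : hom z w) (e : hom w (susp y)) :
  distinguished g h e -> exists x, isomorphic (susp x) w /\
    exists (f : hom x y) (h' : hom z (susp x)), distinguished f g h'.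
Proof.
move=> ghe; have [x [i [j [ji ij]]]] := susp_surj w.
exists x; split; first by exists i, j.
have [|f fgh] := unrotate (g := g) (h := j \oc h) (e := e \oc i).
  apply: TR1_iso (is_iso_idm _) (is_iso_idm _) _ _ _ _ ghe.
  - by exists i; split; [exact: ij | exact: ji].
  - by rewrite comp1m compm1.
  - by rewrite compm1.
  - by rewrite fmap1 comp1m -compmA ij compm1.
by exists f, (j \oc h).
Qed.

(* Three rotations of a triangle yield its suspension with three signs. *)
Lemma desusp_triangle x y z (v : hom (susp x) z) (w : hom z (susp y))
    (s : hom (susp y) (susp (susp x))) :
  distinguished v w s -> exists m, isomorphic (susp m) z /\
    exists (f : hom x m) (g : hom m y) (h : hom y (susp x)), distinguished f g h.
Proof.
move=> vws; have [m [i [j [ji ij]]]] := susp_surj z.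
exists m; split; first by exists i, j.
have [f ef] := susp_full (- (j \oc v)).
have [g eg] := susp_full (- (w \oc i)).
have [h eh] := susp_full (- s).
exists f, g, h; rewrite 3!TR2 ef eg eh !opprK.
apply: TR1_iso (is_iso_idm _) _ (is_iso_idm _) _ _ _ vws.
- by exists i; split; [exact: ij | exact: ji].
- by rewrite compm1.
- by rewrite -compmA ij comp1m compm1.
- by rewrite fmap1 comp1m compm1.
Qed.

(* The octahedral axiom for [h \oc e = 0], whose cone is the biproduct of
   [susp a] and [susp q]. *)
Lemma lift_triangle a b c p q (f : hom a b) (g : hom b c) (h : hom c (susp a))
    (i : hom p q) (e : hom q c) (d : hom c (susp p)) :
  distinguished f g h -> distinguished i e d -> h \oc e = 0 ->
  exists m, is_biproduct a q m /\
    exists (u : hom p m) (v : hom m b) (w : hom b (susp p)), distinguished u v w.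
Proof.
rewrite TR2 TR2 => hfg; rewrite TR2 => edi he0.
have [Z [t [u tu]]] := TR1_cone (h \oc e).
(* The cones of [e] and [h] are [susp p] and [susp b]; TR4 puts [Z] between them. *)
have [v [w [vw _ _ _ _]]] := TR4 edi hfg tu.
have Z_bip : is_biproduct (susp a) (susp q) Z.
  by move: tu; rewrite he0 TR2 fmap0 oppr0 => /split_triangle.
have [m [mZ tri]] := desusp_triangle vw.
exists m; split=> //; apply: susp_biproduct_inv.
exact: is_biproduct_iso (isomorphic_sym mZ) Z_bip.
Qed.

End Triangles.

(** Object classes generate the group, since each element lifts to an integer combination of
    objects. *)
Lemma additive_K0class_ext (k : fieldType) (A : linear_category k) (G : zmodType)
    (phi psi : {additive K0split A -> G}) :
  (forall a, phi (K0class a) = psi (K0class a)) -> phi =1 psi.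
Proof.
move=> phipsi x; rewrite -[x]reprK.
rewrite -[repr x]freeg_sumE !raddf_sum; apply: eq_bigr => a _.
have -> : << coeff a (repr x) *g a >> = (free_class (a : A)) *~ coeff a (repr x).
  by rewrite freeg_mulz intz.
by rewrite !raddfMz phipsi.
Qed.

(** * Index triangles for one cluster tilting subcategory *)

Section Index.
Variables (k : fieldType) (C : triangulated_category k) (T : set C).
Implicit Types (a b c s m : C) (t : full_subcategory T).

Lemma K0class_biproduct_val t t' t'' :
  is_biproduct (val t) (val t') (val t'') ->
  K0class t'' = K0class t + K0class t'.
Proof.
by case=> i1 [i2 [p1 [p2 ?]]]; apply: K0class_biproduct; exists i1, i2, p1, p2.
Qed.

Lemma full_subcategory_obj c : T c -> exists t, val t = c.
Proof. by move=> Tc; exists (SigSub (mem_set Tc)). Qed.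

Lemma full_subcategory_valP t : T (val t).
Proof. exact/set_mem/valP. Qed.

Lemma K0inclE t : K0incl T (K0class t) = K0class (val t).
Proof. exact: K0liftE. Qed.

Hypothesis T_ct : cluster_tilting T.

Lemma cluster_tilting_hom0 a b (f : hom a (susp b)) : T a -> T b -> f = 0.
Proof.
by move=> Ta Tb; case: T_ct Ta => _ _ _ -> Ta; apply: Ta.
Qed.

Lemma cluster_tilting_biproduct a b c :
  is_biproduct a b c -> T a -> T b -> T c.
Proof.
case=> i1 [i2 [p1 [p2 [_ _ _ _ eq1]]]] Ta Tb.
case: T_ct => _ _ _ ->  t Tt f.
rewrite -[f]compm1 -eq1 compmDr !compmA.
by rewrite (cluster_tilting_hom0 (f \oc i1)) ?(cluster_tilting_hom0 (f \oc i2))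
  ?comp0m ?addr0.
Qed.

(** The defining vanishing of maps [desusp t -> c] is read off from maps [t -> susp c] through the
    equivalence. *)
Lemma cluster_tilting_homl0 c :
  (forall a, T a -> forall f : hom a (susp c), f = 0) -> T c.
Proof.
move=> c0; case: T_ct => _ _ -> _ t Tt f; apply: susp_inj.
have [eps [eps_iso _]] := retractionP (desuspK C).
have [e [ee' e'e]] := eps_iso t.
rewrite -[LHS]compm1 -ee' compmA (c0 _ Tt (fmap susp f \oc e)).
by rewrite comp0m fmap0.
Qed.

(** A relation, because the triangle of [s] is a choice; independence of that choice is proved
    below. *)
Definition index_value s (x : K0split (full_subcategory T)) : Prop :=
  exists t1 t0 (f : hom (val t1) (val t0)) (g : hom (val t0) s)
    (h : hom s (susp (val t1))),
    distinguished f g h /\ x = K0class t0 - K0class t1.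

(** A right approximation [g : t0 -> s] is completed to a triangle [c -> t0 -> s], and a
    Wakamatsu-type argument shows that [c] lies in [T]. *)
Lemma index_value_exists s : exists x, index_value s x.
Proof.
have [_ ff _ _] := T_ct; have [[t0 [g [Tt0 g_approx]]] _] := ff s.
have [z [h [e ghe]]] := TR1_cone g.
have [c [_ [f [h' fgh]]]] := triangle_desusp ghe.
have Tc : T c.
  apply: cluster_tilting_homl0 => t Tt u.
  have := fgh; rewrite TR2 TR2 => tri.
  have fu0 : - fmap susp f \oc u = 0.
    exact: cluster_tilting_hom0.
  (* Here [u] factors as [h' \oc v], and [v] lifts along [g], so [u] factors through
     [h' \oc g = 0]. *)
  have [v ->] := triangle_weak_ker tri fu0.
  have [w <-] := g_approx _ Tt v.
  move: fgh; rewrite TR2 => /triangle_comp0 hg0.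
  by rewrite compmA hg0 comp0m.
have [t1 et1] := full_subcategory_obj Tc; have [t0' et0] := full_subcategory_obj Tt0.
move: f g h' fgh {g_approx h ghe e Tt0 Tc}; rewrite -et1 -et0 => f g h fgh.
by exists (K0class t0' - K0class t1), t1, t0', f, g, h.
Qed.

(** A Schanuel-type argument using rigidity twice: [m] is a biproduct of [t1'] and [t0], and the
    triangle [t1 -> m -> t0'] splits, so [[t1'] + [t0] = [t1] + [t0']]. *)
Lemma index_value_unique s x y : index_value s x -> index_value s y -> x = y.
Proof.
case=> [t1 [t0 [f [g [h [fgh ->]]]]]] [t1' [t0' [f' [g' [h' [fgh' ->]]]]]].
have [m [m_bip [u [v [w uvw]]]]] := lift_triangle fgh' fgh
  (cluster_tilting_hom0 (h' \oc g) (full_subcategory_valP t0) (full_subcategory_valP t1')).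
rewrite (cluster_tilting_hom0 w) in uvw; try exact: full_subcategory_valP.
have m_bip' := split_triangle uvw.
have Tm : T m by apply: cluster_tilting_biproduct m_bip _ _; apply: full_subcategory_valP.
have [tm etm] := full_subcategory_obj Tm; rewrite -etm in m_bip m_bip'.
have := K0class_biproduct_val m_bip; rewrite (K0class_biproduct_val m_bip').
move=> e; apply/eqP; rewrite subr_eq addrAC eq_sym subr_eq.
by rewrite [X in _ == X]addrC -e addrC.
Qed.

Lemma index_value_extension t b c (f : hom (val t) b) (g : hom b c)
    (h : hom c (susp (val t))) x :
  distinguished f g h -> index_value c x -> index_value b (K0class t + x).
Proof.
move=> fgh [t1 [t0 [i [e [d [ied ->]]]]]].
have [m [m_bip [u [v [w uvw]]]]] := lift_triangle fgh ied
  (cluster_tilting_hom0 (h \oc e) (full_subcategory_valP t0) (full_subcategory_valP t)).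
have Tm : T m by apply: cluster_tilting_biproduct m_bip _ _; apply: full_subcategory_valP.
have [tm etm] := full_subcategory_obj Tm.
case: _ / etm in m_bip u v uvw Tm.
exists t1, tm, u, v, w; split=> //.
by rewrite (K0class_biproduct_val m_bip) addrA.
Qed.

(** Horseshoe argument: two lifts replace [b] by [b0], then [a] by [a0], giving [n -> m -> c]; the
    octahedral axiom computes the cone of the composite. *)
Lemma index_value_biproduct a b c x y : is_biproduct a b c ->
  index_value a x -> index_value b y -> index_value c (x + y).
Proof.
move=> /biproduct_triangle [ia [pb tri_ab]].
case=> [a1 [a0 [fa [ga [ha [tri_a ->]]]]]] [b1 [b0 [fb [gb [hb [tri_b ->]]]]]].
have [m [m_bip [u [v [w uvw]]]]] := lift_triangle tri_ab tri_b (comp0m _ gb).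
have [ib [pa tri_m]] := biproduct_triangle (is_biproduct_sym m_bip).
have [n [n_bip [u' [v' [w' uvw']]]]] := lift_triangle tri_m tri_a (comp0m _ ga).
have [X [r [q vrq]]] := TR1_cone (v \oc v').
have tri1 := uvw; rewrite TR2 in tri1; have tri2 := uvw'; rewrite TR2 in tri2.
have [i [j [ij _ _ _ _]]] := TR4 tri2 tri1 vrq.
have X_bip : is_biproduct (susp (val a1)) (susp (val b1)) X.
  (* Up to sign the connecting map is the suspension of [w' \oc u : b1 -> susp a1], which is zero by
     rigidity. *)
  move: ij; rewrite compmN -fmapM (cluster_tilting_hom0 (w' \oc u)) ?fmap0 ?oppr0;
    try exact: full_subcategory_valP.
  exact: split_triangle.
have [l [lX [f [r' tri_c]]]] := triangle_desusp vrq.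
have l_bip : is_biproduct (val a1) (val b1) l.
  exact/susp_biproduct_inv/(is_biproduct_iso (isomorphic_sym lX) X_bip).
have Tl : T l by apply: cluster_tilting_biproduct l_bip _ _; apply: full_subcategory_valP.
have Tn : T n by apply: cluster_tilting_biproduct n_bip _ _; apply: full_subcategory_valP.
have [tl etl] := full_subcategory_obj Tl; have [tn etn] := full_subcategory_obj Tn.
have {f r' tri_c} : exists (f : hom l n) (g : hom n c) (h : hom c (susp l)),
  distinguished f g h by exists f, (v \oc v'), r'.
move: l_bip n_bip; rewrite -etl -etn => l_bip n_bip [f [g [h tri_c]]].
exists tl, tn, f, g, h; split=> //.
rewrite (K0class_biproduct_val l_bip) (K0class_biproduct_val n_bip).
by rewrite opprD addrACA [K0class b0 + _]addrC.
Qed.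

(** * The index and coindex homomorphisms *)

Lemma is_index_exists : exists phi, is_index (T := T) phi.
Proof.
have [F FP] := choice index_value_exists.
have FD : biproduct_additive F.
  move=> a b c abc; apply: index_value_unique (FP c) _.
  exact: index_value_biproduct abc (FP a) (FP b).
exists (K0lift FD) => t1 t0 s f g h fgh; rewrite [LHS](K0liftE FD).
by apply: index_value_unique (FP s) _; exists t1, t0, f, g, h.
Qed.

(** Existence rules out the default value of [xget]. *)
Lemma indP : is_index (ind T).
Proof.
rewrite /ind; case: xgetP => [phi _ //|no_index].
by have [phi /no_index] := is_index_exists.
Qed.

Lemma ind_index_value s x : index_value s x -> ind T (K0class s) = x.
Proof. by case=> [t1 [t0 [f [g [h [fgh ->]]]]]]; apply: indP fgh. Qed.

Lemma ind_extension t b c (f : hom (val t) b) (g : hom b c)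
    (h : hom c (susp (val t))) :
  distinguished f g h -> ind T (K0class b) = K0class t + ind T (K0class c).
Proof.
move=> fgh; have [x xP] := index_value_exists c.
by rewrite (ind_index_value xP); apply/ind_index_value/(index_value_extension fgh).
Qed.

Lemma coindex_triangle c : exists t0 t1 (f : hom c (val t0))
    (g : hom (val t0) (val t1)) (h : hom (val t1) (susp c)), distinguished f g h.
Proof.
have [_ [t0 [t1 [g [h [e [ghe _]]]]]]] := index_value_exists (susp c).
by have [f fgh] := unrotate ghe; exists t0, t1, f, g, h.
Qed.

(* Rotating a coindex triangle of [c] gives an index triangle of [susp c]. *)
Lemma is_coindex_exists : exists phi, is_coindex (U := T) phi.
Proof.
pose F c := - ind T (K0class (susp c)).
have FD : biproduct_additive F.
  move=> a b c /(fmap_biproduct susp) abc.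
  by rewrite /F (K0class_biproduct abc) raddfD opprD.
exists (K0lift FD) => c t0 t1 f g h; rewrite TR2 => /indP ind_susp.
by rewrite [LHS](K0liftE FD) /F ind_susp opprB.
Qed.

Lemma coindP : is_coindex (coind T).
Proof.
rewrite /coind; case: xgetP => [phi _ //|no_coindex].
by have [phi /no_coindex] := is_coindex_exists.
Qed.

(** Both sides are evaluated on one coindex triangle of [c], whose rotation is an index triangle of
    [susp c]. *)
Lemma coind_ind_susp c : coind T (K0class c) = - ind T (K0class (susp c)).
Proof.
have [t0 [t1 [f [g [h fgh]]]]] := coindex_triangle c.
by rewrite (coindP fgh); move: fgh; rewrite TR2 => /indP ->; rewrite opprB.
Qed.

End Index.

(** * The two composites, computed on classes of objects *)

Theorem theorem1p2 (k : closedFieldType) (C : triangulated_category k)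
    (C_krull_schmidt : krull_schmidt C) (C_2CY : two_calabi_yau C)
    (T U : set C) (T_ct : cluster_tilting T) (U_ct : cluster_tilting U) :
  cancel (coind_restr U T) (ind_restr T U) /\
  cancel (ind_restr T U) (coind_restr U T).
Proof.
split.
- apply: (additive_K0class_ext (phi := ind_restr T U \o coind_restr U T)
    (psi := idfun)) => t /=.
  have [u0 [u1 [f [g [h fgh]]]]] := coindex_triangle U_ct (val t).
  rewrite K0inclE (coindP U_ct fgh) !raddfB /= !K0inclE.
  by rewrite (ind_extension T_ct fgh) addrK.
- apply: (additive_K0class_ext (phi := coind_restr U T \o ind_restr T U)
    (psi := idfun)) => u /=.
  have [_ [t1 [t0 [f [g [h [fgh _]]]]]]] := index_value_exists T_ct (val u).
  rewrite K0inclE (indP T_ct fgh) !raddfB /= !K0inclE !(coind_ind_susp U_ct).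
  (* Two rotations give [u -> susp t1 -> susp t0 -> susp u], so the index of [susp t1] with respect
     to [U] is [[u]] plus that of [susp t0]. *)
  move: fgh; rewrite TR2 TR2 => /(ind_extension U_ct) ->.
  by rewrite opprK addrC addrK.
Qed.
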